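(* Let $\mathbf{k}$ be a commutative ring, let $k\in\mathbb{N}$, let $n\geq k$ be an integer, and let $a_1,a_2,\ldots,a_k\in\mathbf{k}$. Let $\mathcal{S}$ be the ring of symmetric polynomials in $\mathbf{k}[x_1,\ldots,x_k]$, and let $I$ be the ideal of $\mathcal{S}$ generated by $h_{n-k+1}-a_1,\ h_{n-k+2}-a_2,\ \ldots,\ h_n-a_k$. Let $\lambda\in P_{k,n}$ and $j\in\{0,1,\ldots,n-k\}$. Then, in $\mathcal{S}/I$, \[ \overline{s_\lambda h_j}=\sum_{\substack{\mu\in P_{k,n};\\ \mu/\lambda\text{ is a horizontal }j\text{-strip}}}\overline{s_\mu}-\sum_{i=1}^{k}(-1)^i a_i\,\overline{\left(\mathbf{s}_{(n-k-j+1,1^{i-1})}\right)^{\perp}\mathbf{s}_\lambda}. \]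
   Context: $h_m$ and $s_\lambda$ are the complete homogeneous symmetric polynomials and Schur polynomials in $x_1,\ldots,x_k$. $P_{k,n}$ is the set of all partitions with at most $k$ parts, all of which are $\leq n-k$. $\Lambda$ is the ring of symmetric functions over $\mathbf{k}$ in infinitely many variables $x_1,x_2,x_3,\ldots$; $\mathbf{s}_\lambda\in\Lambda$ and $\mathbf{s}_{\lambda/\mu}\in\Lambda$ are Schur and skew Schur functions (with $\mathbf{s}_{\lambda/\mu}=0$ unless $\mu\subseteq\lambda$). For $\mathbf{f}\in\Lambda$, the skewing operator $\mathbf{f}^\perp:\Lambda\to\Lambda$ is $\mathbf{k}$-linear, depends $\mathbf{k}$-linearly on $\mathbf{f}$, and is determined by $(\mathbf{s}_\mu)^\perp(\mathbf{s}_\lambda)=\mathbf{s}_{\lambda/\mu}$ for all partitions $\lambda,\mu$. For $p\in\mathcal{S}$, $\overline{p}$ is its residue class in $\mathcal{S}/I$; for $\mathbf{f}\in\Lambda$, $\overline{\mathbf{f}}\in\mathcal{S}/I$ is the residue class of the symmetric polynomial $\mathbf{f}(x_1,\ldots,x_k)$ obtained by evaluating $\mathbf{f}$ at the $k$ variables $x_1,\ldots,x_k$ (that is, setting $x_{k+1}=x_{k+2}=\cdots=0$). $(m,1^{r})$ is the partition with first entry $m$ followed by $r$ entries equal to $1$. A horizontal $j$-strip is a skew partition $\mu/\lambda$ (with $\lambda\subseteq\mu$) with $|\mu|-|\lambda|=j$ whose diagram has no two boxes in the same column. *)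

(* Defs.v *)
From mathcomp Require Import all_boot all_order all_algebra.
From mathcomp Require Import finmap.
From mathcomp.multinomials Require Import mpoly.
From Stdlib Require Import ClassicalEpsilon.

Set Implicit Arguments.
Unset Strict Implicit.
Unset Printing Implicit Defensive.

Import GRing.Theory.
Local Open Scope ring_scope.

(** Partitions are weakly decreasing sequences of naturals.  Trailing zeros are
    allowed and immaterial: every notion below depends only on the numbers
    [part lam i], the (i+1)-st part of [lam]. *)

Definition is_partition (lam : seq nat) : bool := sorted geq lam.

Definition part (lam : seq nat) (i : nat) : nat := nth 0%N lam i.

Definition included (mu lam : seq nat) : bool :=
  all (fun i => part mu i <= part lam i)%N (iota 0 (size mu)).

(** Boxes (row, column) of the diagram of lam/mu, in English notation and
    counted from 0. *)
Definition boxes (lam mu : seq nat) : {fset nat * nat} :=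
  [fset b in [seq (r, c) | r <- iota 0 (size lam),
                           c <- iota 0 (part lam r)] | (part mu b.1 <= b.2)%N]%fset.

(** A k-tuple of entries at most n - k encodes a partition with at most k parts,
    all at most n - k, padded with zeros. *)
Definition parts k n (lam : k.-tuple 'I_(n - k).+1) : seq nat := map val lam.

Definition Pkn k n : {set k.-tuple 'I_(n - k).+1} :=
  [set lam : k.-tuple 'I_(n - k).+1 | is_partition (parts lam)].

Definition horizontal_strip (j : nat) (mu lam : seq nat) : bool :=
  [&& included lam mu, sumn mu == (sumn lam + j)%N &
      [forall b : boxes mu lam, forall b' : boxes mu lam,
        ((val b).2 == (val b').2) ==> (b == b')]].

(** [T] weakly increases along rows and strictly increases down columns. *)
Definition semistandard (lam mu : seq nat) (T : boxes lam mu -> nat) : bool :=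
  [forall b : boxes lam mu, forall b' : boxes lam mu,
    (((val b).1 == (val b').1) && ((val b).2 <= (val b').2) ==> (T b <= T b'))
    && (((val b).2 == (val b').2) && ((val b).1 < (val b').1) ==> (T b < T b'))]%N.

Section SymmetricPolynomials.
Variables (R : comNzRingType) (k : nat).

Definition hsym (m : nat) : {mpoly R[k]} :=
  \sum_(t : 'X_{1..k < m.+1} | mdeg t == m) 'X_[t].

Definition schur_poly (lam : seq nat) : {mpoly R[k]} :=
  \sum_(T : {ffun boxes lam [::] -> 'I_k} | semistandard (fun b => val (T b)))
    \prod_b 'X_(T b).

(** Membership in the ideal generated by the [g i] of the ring of symmetric
    polynomials: the coefficients have to be symmetric too. *)
Definition in_sym_ideal (g : 'I_k -> {mpoly R[k]}) (p : {mpoly R[k]}) : Prop :=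
  exists2 c : 'I_k -> {mpoly R[k]},
    forall i, c i \is symmetric & p = \sum_i c i * g i.

(** [a i] is a_{i+1}, so these are h_{n-k+1} - a_1, ..., h_n - a_k. *)
Definition idealI_gen (n : nat) (a : 'I_k -> R) (i : 'I_k) : {mpoly R[k]} :=
  hsym (n - k + i.+1) - (a i)%:MP.

(** Equality of the residue classes of [p] and [q] in S/I. *)
Definition eq_mod_I (n : nat) (a : 'I_k -> R) (p q : {mpoly R[k]}) : Prop :=
  in_sym_ideal (idealI_gen n a) (p - q).

End SymmetricPolynomials.

(** Monomials in x_0, x_1, x_2, ... as finitely supported exponent functions. *)
Definition monomial := {fsfun nat -> nat with 0%N}.

Definition mondeg (m : monomial) : nat := (\sum_(i <- finsupp m) m i)%N.

Section SymmetricFunctions.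
Variable R : comNzRingType.

(** Formal power series in x_0, x_1, ..., given by their coefficients. *)
Definition series := monomial -> R.

Definition bounded_degree (f : series) : Prop :=
  exists d, forall m, (d < mondeg m)%N -> f m = 0.

(** [Lambda f]: the series [f] belongs to the ring of symmetric functions. *)
Definition Lambda (f : series) : Prop :=
  bounded_degree f /\
  forall (s : nat -> nat) (m m' : monomial),
    bijective s -> (forall i, m' i = m (s i)) -> f m' = f m.

(** The sum of x^T over all semistandard tableaux T of shape lam/mu with entries
    in nat: the coefficient of a monomial [m] counts those of content [m], whose
    entries necessarily lie in the support of [m]. *)
Definition skew_schur (lam mu : seq nat) : series := fun m =>
  if included mu lam then
    #|[set T : {ffun boxes lam mu -> finsupp m} |
        semistandard (fun b => val (T b)) &
        [forall i : finsupp m, #|[set b | T b == i]| == m (val i)]]|%:R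
  else 0.

Definition schur (lam : seq nat) : series := skew_schur lam [::].

Definition lincomb (c : R) (f g : series) : series := fun m => c * f m + g m.

(** [perp f] is the skewing operator f^perp; its values on arguments that are not
    symmetric functions are irrelevant. *)
Definition is_skewing (perp : series -> series -> series) : Prop :=
  [/\ forall f g, Lambda f -> Lambda g -> Lambda (perp f g),
      forall f c g h, Lambda f -> Lambda g -> Lambda h ->
        perp f (lincomb c g h) = lincomb c (perp f g) (perp f h),
      forall c f g h, Lambda f -> Lambda g -> Lambda h ->
        perp (lincomb c f g) h = lincomb c (perp f h) (perp g h) &
      forall lam mu, is_partition lam -> is_partition mu ->
        perp (schur mu) (schur lam) = skew_schur lam mu].

Definition monomial_of k (m : 'X_{1..k}) : monomial :=
  [fsfun i in [fset i in iota 0 k]%fset => part m i | 0%N].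

(** f(x_0, ..., x_{k-1}): setting the other variables to 0 keeps exactly the
    coefficients of the monomials in x_0, ..., x_{k-1}.  This determines the
    polynomial, which exists as soon as [f] has bounded degree. *)
Definition evalk k (f : series) : {mpoly R[k]} :=
  epsilon (inhabits (0 : {mpoly R[k]}))
    (fun p : {mpoly R[k]} => forall m, p@_m = f (monomial_of m)).

Lemma mondeg_monomial_of k (m : 'X_{1..k}) : mondeg (monomial_of m) = mdeg m.
Proof.
have sub : (finsupp (monomial_of m) `<=` [fset i in iota 0 k])%fset.
  exact: finsupp_sub.
rewrite /mondeg (big_fset_incl _ sub) /=; last by move=> i _ /fsfun_dflt ->.
have /(perm_big _) -> /= : perm_eq [fset i in iota 0 k]%fset (iota 0 k).
  by apply: uniq_perm (fset_uniq _) (iota_uniq _ _) _ => i; rewrite !inE.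
have -> : mdeg m = (\sum_(i < k) part m i)%N.
  by rewrite mdegE; apply: eq_bigr => i _; rewrite (mnm_nth 0%N).
rewrite -(big_mkord xpredT (fun i => part m i)) /index_iota subn0.
rewrite [RHS]big_seq [LHS]big_seq.
by apply: eq_bigr => i ik; rewrite fsfunE !inE ik.
Qed.

Lemma evalkE k (f : series) (m : 'X_{1..k}) :
  bounded_degree f -> (evalk k f)@_m = f (monomial_of m).
Proof.
move=> [d fd]; move: m; rewrite /evalk.
pose coefs (p : {mpoly R[k]}) := forall m, p@_m = f (monomial_of m).
refine (epsilon_spec (inhabits (0 : {mpoly R[k]})) coefs _).
exists (\sum_(t : 'X_{1..k < d.+1}) f (monomial_of t) *: 'X_[t]) => m.
have [le_md|lt_dm] := leqP (mdeg m) d.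
  by rewrite (mcoeff_mpoly (fun t => f (monomial_of t))).
rewrite fd ?mondeg_monomial_of// raddf_sum big1// => t _ /=.
rewrite mcoeffZ mcoeffX; case: eqP => [tm|_]; last by rewrite mulr0.
by case: t tm => t /= lt_td tm; move: lt_td; rewrite tm ltnS leqNgt lt_dm.
Qed.

End SymmetricFunctions.

(* Main.v *)
(** Put [N = n - k] and [m = N - j].  The Jacobi-Trudi determinant of the skew
    shape [(N, lam) / (m)] can be computed in two ways.  Expanding it along its
    first row [h_j, h_{N+1}, ..., h_{N+k}] gives
      [h_j s_lam + sum_{i = 1}^k (-1)^i h_{N+i} s_{lam / (m+1, 1^{i-1})}],
    whereas skewing by [h_m] removes a horizontal strip of size [m] from
    [(N, lam)], which in [k] variables gives the sum of the [s_mu] with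
    [mu_1 <= N] and [mu / lam] a horizontal [j]-strip.  Modulo [I] each [h_{N+i}]
    may be replaced by [a_i].

    The Jacobi-Trudi formula itself is proved by removing one variable at a time:
    subtracting suitable multiples of consecutive rows leaves row [i] as a sum over
    the interval [lam_{i+1}, lam_i], so that multilinearity yields exactly the sum
    over horizontal strips, without cancellation. *)

Require Import Defs.
From mathcomp Require Import all_boot all_order all_algebra.
From mathcomp Require Import finmap.
From mathcomp.multinomials Require Import mpoly.
From mathcomp Require Import zify ring.

Set Implicit Arguments.
Unset Strict Implicit.
Unset Printing Implicit Defensive.

Import GRing.Theory.
Local Open Scope ring_scope.

Local Arguments part : simpl never.

(** * Partitions, boxes and horizontal strips *)

Lemma is_partitionP lam :
  reflect (forall i, part lam i.+1 <= part lam i)%N (is_partition lam).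
Proof.
rewrite /is_partition /part; apply: (iffP idP) => [|le_lam].
  move=> /(sortedP 0%N) le_lam i; case: (ltnP i.+1 (size lam)) => [/le_lam//|].
  by move=> /(nth_default 0%N) ->.
by apply/(sortedP 0%N) => i _; apply: le_lam.
Qed.

Lemma part_le lam i j : is_partition lam -> (i <= j)%N -> (part lam j <= part lam i)%N.
Proof.
move=> /is_partitionP le_lam; elim: j => [|j IH]; first by rewrite leqn0 => /eqP ->.
rewrite leq_eqVlt => /predU1P[->//|]; rewrite ltnS => /IH.
exact: leq_trans.
Qed.

Lemma includedP mu lam :
  reflect (forall i, part mu i <= part lam i)%N (included mu lam).
Proof.
apply: (iffP allP) => [le_mu i|le_mu i _]; last exact: le_mu.
case: (ltnP i (size mu)) => [lt_i|ge_i]; first by apply: le_mu; rewrite mem_iota.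
by rewrite /part nth_default.
Qed.

Lemma part_singleton m i : (0 < i)%N -> part [:: m] i = 0%N.
Proof. by case: i => [|[]]. Qed.

Lemma sumn_part L s : (size s <= L)%N -> sumn s = (\sum_(i < L) part s i)%N.
Proof.
elim: s L => [|x s IH] [|L]//= le; first by rewrite big_ord0.
  by rewrite big1// => i _; rewrite /part nth_nil.
by rewrite big_ord_recl (IH L).
Qed.

Lemma in_boxes lam mu p :
  (p \in boxes lam mu) = (part mu p.1 <= p.2 < part lam p.1)%N.
Proof.
rewrite !inE /=; case: p => r c /=; rewrite andbC; congr (_ && _).
apply/allpairsPdep/idP => [[x [y [_ ]]]|lt_c].
  by rewrite mem_iota => + [-> ->].
exists r, c; rewrite !mem_iota /=; split => //; rewrite ltnNge.
by apply/negP => ge_r; move: lt_c; rewrite /part nth_default.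
Qed.

Lemma size_parts k n (lam : k.-tuple 'I_(n - k).+1) : size (parts lam) = k.
Proof. by rewrite size_map size_tuple. Qed.

Lemma part_parts k n (lam : k.-tuple 'I_(n - k).+1) (i : 'I_k) :
  part (parts lam) i = tnth lam i.
Proof.
by rewrite /part (nth_map ord0) ?size_tuple// -tnth_nth.
Qed.

(** If [part mu i.+1] exceeded [part lam i], rows [i] and [i.+1] of mu/lam would share the column
    [part lam i]. Conversely, interlacing keeps boxes of different rows in different columns. *)
Lemma horizontal_stripP j mu lam : is_partition mu -> is_partition lam ->
  reflect
    ((forall i, part lam i <= part mu i) /\ (forall i, part mu i.+1 <= part lam i)
     /\ sumn mu = sumn lam + j)%N
    (horizontal_strip j mu lam).
Proof.
move=> muP lamP; apply: (iffP and3P).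
  move=> [/includedP le_lam /eqP szj /forallP hs]; split=> //; split=> // i.
  rewrite leqNgt; apply/negP => lt_i.
  have le_mu := is_partitionP _ muP i; have le_la := is_partitionP _ lamP i.
  have b1 : (i, part lam i) \in boxes mu lam by rewrite in_boxes /=; lia.
  have b2 : (i.+1, part lam i) \in boxes mu lam by rewrite in_boxes /=; lia.
  have /forallP/(_ [` b2]%fset) := hs [` b1]%fset.
  by rewrite /= eqxx /= => /eqP/(congr1 val) [] /n_Sn.
move=> [le_lam [il szj]]; split; [exact/includedP | exact/eqP |].
apply/forallP => -[[r u] ru]; apply/forallP => -[[s v] sv].
apply/implyP => /= /eqP e; apply/eqP/val_inj => /=; subst v.
have main r' s' : (r' < s')%N -> (r', u) \in boxes mu lam ->
    (s', u) \in boxes mu lam -> False.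
  move=> lt; rewrite !in_boxes /=.
  by have := part_le muP lt; have := il r'; lia.
by case: (ltngtP r s) => [lt|lt|->//]; [case: (main _ _ lt ru sv)|case: (main _ _ lt sv ru)].
Qed.

(** * Jacobi-Trudi determinants and horizontal strips *)

Section JacobiTrudi.
Variable A : comNzRingType.
Implicit Types (t : nat -> nat -> A) (y : A) (lam mu : seq nat).

(* If [t a b] is [h_{a-b}] of some variables, then [step y t a b] is [h_{a-b}] of
   these variables and [y]. *)
Definition step y t a b : A := \sum_(0 <= c < a.+1) y ^+ (a - c) * t c b.

(* The indices are the beta-numbers [lam_i + L - i]: the entry is
   [h_{lam_i - mu_j - i + j}], without truncated subtraction. *)
Definition jacobi_trudi L t lam mu : A :=
  \det (\matrix_(i < L, j < L)
    t (part lam i + (L - i.+1))%N (part mu j + (L - j.+1))%N).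

Lemma stepS y t a b :
  step y t a.+1 b = t a.+1 b + y * step y t a b.
Proof.
rewrite /step big_nat_recr//= subnn expr0 mul1r addrC; congr (_ + _).
rewrite mulr_sumr !big_nat; apply: eq_bigr => c /andP[_ lt_c].
by rewrite mulrA -exprS subSn.
Qed.

Lemma eq_jacobi_trudi L (t t' : nat -> nat -> A) lam lam' mu mu' :
    t =2 t' -> part lam =1 part lam' -> part mu =1 part mu' ->
  jacobi_trudi L t lam mu = jacobi_trudi L t' lam' mu'.
Proof.
move=> tt' ll' mm'; congr (\det _).
by apply/matrixP => i j; rewrite !mxE tt' ll' mm'.
Qed.

(** Bounding the parts by [B] makes the sums over shapes below finite sums over functions. *)
Definition fseq L B (f : {ffun 'I_L -> 'I_B}) : seq nat :=
  [seq val (f i) | i <- enum 'I_L].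

Lemma size_fseq L B (f : {ffun 'I_L -> 'I_B}) : size (fseq f) = L.
Proof. by rewrite size_map size_enum_ord. Qed.

Lemma part_fseq L B (f : {ffun 'I_L -> 'I_B}) (i : 'I_L) : part (fseq f) i = f i.
Proof.
by rewrite /part (nth_map i) ?size_enum_ord// nth_ord_enum.
Qed.

(** For a partition [lam] with at most [L] parts: [f] arises from [lam] by removing a horizontal
    strip of arbitrary size. *)
Definition interlace L B lam : pred {ffun 'I_L -> 'I_B} :=
  [pred f : {ffun 'I_L -> 'I_B} |
    [forall i : 'I_L, part lam i.+1 <= f i <= part lam i]%N].

Lemma interlace_partition L B lam (f : {ffun 'I_L -> 'I_B}) :
  interlace lam f -> is_partition (fseq f).
Proof.
move=> /forallP fP; apply/is_partitionP => i.
have [lt_i|ge_i] := ltnP i.+1 L; last by rewrite /part nth_default ?size_fseq.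
have := fP (Ordinal lt_i); have := fP (Ordinal (ltnW lt_i)).
by rewrite -!part_fseq /=; lia.
Qed.

(** A unitriangular matrix; multiplying by it performs row or column operations without changing the
    determinant. *)
Lemma det_superdiagonal L (c : 'I_L -> A) :
  \det (\matrix_(i < L, j < L) ((i == j)%:R - (i.+1 == j)%:R * c i)) = 1.
Proof.
rewrite -det_tr det_trig; last first.
  apply/is_trig_mxP => i j lt_ij; rewrite !mxE.
  have -> : (j == i) = false by apply/negbTE; rewrite -val_eqE /=; lia.
  have -> : (j.+1 == i) = false by lia.
  by rewrite mul0r subr0.
rewrite big1// => i _; rewrite !mxE eqxx.
have -> : (i.+1 == i) = false by lia.
by rewrite mul0r subr0.
Qed.

(** Multilinearity in the rows: in the Leibniz formula, each product of row sums is expanded over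
    all choices [f] of one term per row. *)
Lemma det_row_expansion L B (Q : 'I_L -> pred 'I_B) (w : 'I_L -> 'I_B -> A)
    (M : 'I_L -> 'I_B -> 'I_L -> A) :
  \det (\matrix_(i, j) \sum_(v | Q i v) w i v * M i v j) =
  \sum_(f : {ffun 'I_L -> 'I_B} | [forall i, Q i (f i)])
     (\prod_i w i (f i)) * \det (\matrix_(i, j) M i (f i) j).
Proof.
rewrite /determinant.
under eq_bigr => s _.
  under eq_bigr => i _ do rewrite mxE.
  rewrite bigA_distr_big_dep mulr_sumr; over.
rewrite exchange_big; apply: eq_big => [f|f _].
  by apply/familyP/forallP.
rewrite mulr_sumr; apply: eq_bigr => s _.
rewrite mulrCA -big_split; congr (_ * _); apply: eq_bigr => i _.
by rewrite mxE.
Qed.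

(** After multiplication by the power of [y], the second sum agrees with the initial terms of the
    first. The remaining indices, lowered by [L - i.+1], run from [part lam i.+1] to
    [part lam i]. *)
Lemma step_rows y t lam b L i : is_partition lam -> (i.+1 < L)%N ->
  step y t (part lam i + (L - i.+1)) b -
    y ^+ (part lam i - part lam i.+1).+1 * step y t (part lam i.+1 + (L - i.+2)) b =
  \sum_(part lam i.+1 <= v < (part lam i).+1)
    y ^+ (part lam i - v) * t (v + (L - i.+1))%N b.
Proof.
move=> /is_partitionP/(_ i); set p := part lam i; set q := part lam i.+1 => le_qp lt_i.
have -> : (L - i.+1 = (L - i.+2).+1)%N by lia.
set e := (L - i.+2)%N.
rewrite /step (@big_cat_nat _ _ _ (q + e).+1)//=; try lia.
rewrite mulr_sumr [X in X + _ - _](_ : _ =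
   \sum_(0 <= c < (q + e).+1) y ^+ (p - q).+1 * (y ^+ (q + e - c) * t c b)); last first.
  rewrite !big_nat; apply: eq_bigr => c /andP[_ lt_c]; rewrite mulrA -exprD.
  by congr (y ^+ _ * _); lia.
rewrite addrAC subrr add0r -[(q + e).+1]addnS big_addn.
have -> : ((p + e.+1).+1 - e.+1 = p.+1)%N by lia.
by apply: eq_bigr => v _; congr (y ^+ _ * _); lia.
Qed.

Lemma jacobi_trudi_step L B y t lam mu :
    is_partition lam -> (size lam <= L)%N -> (part lam 0 < B)%N ->
  jacobi_trudi L (step y t) lam mu =
  \sum_(f : {ffun 'I_L -> 'I_B} | interlace lam f)
    (\prod_(i < L) y ^+ (part lam i - f i)) * jacobi_trudi L t (fseq f) mu.
Proof.
move=> lamP szlam ltB.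
(* [U] subtracts from each row the multiple of the next row prescribed by [step_rows]. *)
pose U : 'M[A]_L := \matrix_(i, i')
  ((i == i')%:R - (i.+1 == i')%:R * y ^+ (part lam i - part lam i.+1).+1).
have detU : \det U = 1 by exact: det_superdiagonal.
rewrite /jacobi_trudi; set W := (X in \det X = _).
have -> : \det W = \det (U *m W) by rewrite det_mulmx detU mul1r.
transitivity (\sum_(f : {ffun 'I_L -> 'I_B} | interlace lam f)
    (\prod_(i < L) y ^+ (part lam i - f i)) *
    \det (\matrix_(i < L, j < L) t (f i + (L - i.+1))%N (part mu j + (L - j.+1))%N)); last first.
  apply: eq_bigr => f _; congr (_ * _); congr (\det _); apply/matrixP => i j.
  by rewrite !mxE part_fseq.
rewrite -(@det_row_expansion L B
  (fun i v => part lam i.+1 <= v <= part lam i)%N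
  (fun i v => y ^+ (part lam i - v))
  (fun i v j => t (v + (L - i.+1)) (part mu j + (L - j.+1)))%N).
congr (\det _); apply/matrixP => i j; rewrite !mxE.
set b := (part mu j + _)%N.
transitivity (\sum_(part lam i.+1 <= v < (part lam i).+1)
    y ^+ (part lam i - v) * t (v + (L - i.+1))%N b); last first.
  have lei : (part lam i < B)%N by apply: leq_ltn_trans ltB; exact: part_le.
  rewrite (big_nat_widenl _ 0%N)//= (big_nat_widen _ _ B)//= big_mkord.
  by apply: eq_bigl => v; rewrite ltnS andbC.
under eq_bigr => i' _ do rewrite !mxE mulrBl.
rewrite sumrB (bigD1 i)//= eqxx mul1r [X in _ + X - _]big1 ?addr0; last first.
  by move=> i' /negbTE; rewrite eq_sym => ->; rewrite mul0r.
case: (ltnP i.+1 L) => [lt_i|ge_i].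
  rewrite -step_rows//; congr (_ - _).
  rewrite (bigD1 (Ordinal lt_i))//= eqxx mul1r big1 ?addr0// => i' ne_i'.
  have -> : (i.+1 == i' :> nat) = false.
    by apply/negbTE; apply: contra ne_i' => /eqP e; apply/eqP/val_inj.
  by rewrite !mul0r.
(* The last row has no successor. Its index shift and the part of [lam] after it are both 0, so it
   already is a sum over the full interval from 0 to [part lam i]. *)
rewrite big1 ?subr0; last first.
  move=> i' _; have -> : (i.+1 == i' :> nat) = false by have := ltn_ord i'; lia.
  by rewrite !mul0r.
have -> : part lam i.+1 = 0%N by rewrite /part nth_default//; lia.
have -> : (L - i.+1 = 0)%N by lia.
by rewrite /step !addn0; apply: eq_bigr => v _; rewrite addn0.
Qed.

(** This is the case of no variables. Beta-numbers strictly decrease, so equal shapes give the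
    identity matrix. At the first index where the shapes differ, the row vanishes if [lam] is larger
    there, the column if [mu] is. *)
Lemma jacobi_trudi_delta L lam mu : is_partition lam -> is_partition mu ->
  jacobi_trudi L (fun a b => (a == b)%:R) lam mu =
  [forall i : 'I_L, part lam i == part mu i]%:R.
Proof.
move=> lamP muP; case: (boolP [forall i, _]) => [/forallP eq_lam|].
  rewrite /jacobi_trudi (_ : (\matrix_(i, j) _) = 1%:M) ?det1//.
  apply/matrixP => i j; rewrite !mxE (eqP (eq_lam i)); congr (nat_of_bool _)%:R.
  rewrite -val_eqE /=; apply/eqP/eqP => [|->//].
  have lt_i := ltn_ord i; have lt_j := ltn_ord j.
  have [le_ij|lt_ji] := leqP i j; first by have := part_le muP le_ij; lia.
  by have := part_le muP (ltnW lt_ji); lia.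
rewrite negb_forall => /existsP[i0 ne_i0].
have [i ne_i min_i] := @arg_minnP _ i0 (fun i : 'I_L => part lam i != part mu i) val ne_i0.
have eq_lt (j : 'I_L) : (j < i)%N -> part lam j = part mu j.
  by move=> lt_j; apply/eqP; apply: contraTT lt_j => /min_i /=; rewrite -leqNgt.
case: (ltngtP (part lam i) (part mu i)) ne_i => // lt_i _.
  rewrite /jacobi_trudi -det_tr (expand_det_row _ i) big1// => j _.
  rewrite !mxE (_ : (_ == _) = false) ?mul0r//.
  case: (ltnP j i) => [lt_j|le_j].
    by rewrite eq_lt//; have := part_le muP (ltnW lt_j); have := ltn_ord i; lia.
  by have := part_le lamP le_j; have := ltn_ord j; lia.
rewrite /jacobi_trudi (expand_det_row _ i) big1// => j _.
rewrite !mxE (_ : (_ == _) = false) ?mul0r//.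
case: (ltnP j i) => [lt_j|le_j].
  by rewrite -eq_lt//; have := part_le lamP (ltnW lt_j); have := ltn_ord i; lia.
by have := part_le muP le_j; have := ltn_ord j; lia.
Qed.

End JacobiTrudi.

(** * Semistandard tableaux *)

(** [G] is defined on all pairs, so that tableaux of different shapes can be compared without
    transporting box membership. *)
Lemma semistandardP lam mu (T : boxes lam mu -> nat) (G : nat * nat -> nat) :
    (forall b, T b = G (val b)) ->
  reflect
    ((forall r u v : nat, (r, u) \in boxes lam mu -> (r, v) \in boxes lam mu ->
        (u <= v)%N -> (G (r, u) <= G (r, v))%N) /\
     (forall r s u : nat, (r, u) \in boxes lam mu -> (s, u) \in boxes lam mu ->
        (r < s)%N -> (G (r, u) < G (s, u))%N))
    (semistandard T).
Proof.
move=> TG; apply: (iffP forallP) => [ssT|[rowT colT] b].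
  split=> [r u v ru rv le_uv|r s u ru su lt_rs].
    have /forallP/(_ [` rv]%fset)/andP[/implyP] := ssT [` ru]%fset.
    by rewrite !TG /= eqxx le_uv => /(_ isT).
  have /forallP/(_ [` su]%fset)/andP[_ /implyP] := ssT [` ru]%fset.
  by rewrite !TG /= eqxx lt_rs => /(_ isT).
apply/forallP => b'; rewrite !TG.
case: b => [[r u] ru]; case: b' => [[s v] sv] /=.
apply/andP; split; apply/implyP => /andP[/eqP e le]; subst.
  exact: rowT.
exact: colT.
Qed.

(* Boxes outside [E] get the value [c], the letter that is about to be added. *)
Definition ext (E : {fset nat * nat}) c (T : {ffun E -> 'I_c}) (p : nat * nat) : nat :=
  if insub p is Some e then val (T e) else c.

Section Extension.
Variables (E : {fset nat * nat}) (c : nat) (T : {ffun E -> 'I_c}).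

Lemma ext_val (e : E) : ext T (val e) = T e.
Proof. by rewrite /ext valK. Qed.

Lemma ext_out p : p \notin E -> ext T p = c.
Proof. by move=> pE; rewrite /ext insubN. Qed.

Lemma ext_lt p : (ext T p < c)%N = (p \in E).
Proof.
have [pE|/ext_out ->] := boolP (p \in E); last by rewrite ltnn.
by rewrite -[p]/(val [` pE]%fset) ext_val ltn_ord.
Qed.

Lemma ext_le p : (ext T p <= c)%N.
Proof. by have [/ext_out->//|] := boolP (p \notin E); rewrite negbK -ext_lt => /ltnW. Qed.

End Extension.

Lemma prod_boxes (A : comNzRingType) L lam mu (G : nat * nat -> A) :
    (size lam <= L)%N ->
  \prod_(b : boxes lam mu) G (val b) =
  \prod_(i < L) \prod_(part mu i <= v < part lam i) G (val i, v).
Proof.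
move=> szlam; rewrite -(big_seq_fsetE _ _ xpredT).
pose s := [seq (r, v) | r <- iota 0 L, v <- index_iota (part mu r) (part lam r)].
have /(perm_big _) -> : perm_eq (boxes lam mu) s.
  apply: uniq_perm; first exact: fset_uniq.
    apply: allpairs_uniq_dep => [|r _|[r v] [r' v'] _ _ /=]; try exact: iota_uniq.
    by case=> -> ->.
  move=> [r v]; rewrite in_boxes /=; apply/idP/allpairsPdep => [|[r' [v' [_]]]].
    move=> lt_v; exists r, v; rewrite mem_iota mem_index_iota; split => //=.
    case: ltnP => // le_r; case/andP: lt_v => _.
    by rewrite /part [X in (_ < X)%N]nth_default//; lia.
  by rewrite mem_index_iota => lt_v [-> ->].
rewrite /s big_allpairs_dep.
have -> : iota 0 L = index_iota 0 L by rewrite /index_iota subn0.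
by rewrite big_mkord.
Qed.

Section Tableaux.
Variables (A : comNzRingType) (x : nat -> A).

(** For [mu] inside [lam], the skew Schur polynomial of lam/mu in the first [c] of the [x i]. *)
Definition tableau_sum lam mu c : A :=
  \sum_(T : {ffun boxes lam mu -> 'I_c} | semistandard (fun b => val (T b)))
    \prod_b x (T b).

Section Restriction.
Variables (L B : nat) (lam mu : seq nat).
Hypotheses (lamP : is_partition lam) (muP : is_partition mu).
Hypotheses (szlam : (size lam <= L)%N) (ltB : (part lam 0 < B)%N).
Hypothesis le_mu : included mu lam.

Definition sublevel c (T : {ffun boxes lam mu -> 'I_c.+1}) (f : {ffun 'I_L -> 'I_B}) :=
  [forall b, (T b < c)%N == (val b \in boxes (fseq f) mu)].

Definition inner : pred {ffun 'I_L -> 'I_B} :=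
  [pred f | interlace lam f && included mu (fseq f)].

Lemma innerP f : inner f ->
  (forall i, part lam i.+1 <= part (fseq f) i <= part lam i)%N /\
  (forall i, part mu i <= part (fseq f) i)%N.
Proof.
case/andP => /forallP fP /includedP muf; split=> // i.
have [lt_i|ge_i] := ltnP i L.
  by have := fP (Ordinal lt_i); rewrite -part_fseq.
by rewrite /part !nth_default ?size_fseq//; lia.
Qed.

(** Row [i] of [f] ends at the first column from [part mu i] on where the row of [lam] ends or the
    largest letter [c] occurs. As rows weakly increase, the smaller letters are exactly those to the
    left. *)
Lemma sublevel_exists c (T : {ffun boxes lam mu -> 'I_c.+1}) :
  semistandard (fun b => val (T b)) -> exists2 f, inner f & sublevel T f.
Proof.
pose G := ext T; have TG b : val (T b) = G (val b) by rewrite /G ext_val.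
move=> /(semistandardP TG)[rowT colT].
have muL := includedP _ _ le_mu.
pose P i v := (part mu i <= v)%N && ((part lam i <= v)%N || (c <= G (i, v))%N).
have exP i : exists v, P i v by exists (part lam i); rewrite /P muL leqnn.
have le_ex i : (ex_minn (exP i) <= part lam i)%N.
  by case: ex_minnP => v _; apply; rewrite /P muL leqnn.
pose f : {ffun 'I_L -> 'I_B} := [ffun i : 'I_L =>
  Ordinal (leq_ltn_trans (leq_trans (le_ex i) (part_le lamP (leq0n i))) ltB)].
have partf i : part (fseq f) i = ex_minn (exP i).
  have [lt_i|ge_i] := ltnP i L.
    by rewrite -[i]/(val (Ordinal lt_i)) part_fseq ffunE.
  rewrite /part nth_default ?size_fseq//; apply/esym/eqP; rewrite -leqn0.
  by apply: leq_trans (le_ex i) _; rewrite /part nth_default//; lia.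
have inlam i v : (part mu i <= v)%N -> (v < part lam i)%N -> (i, v) \in boxes lam mu.
  by move=> *; rewrite in_boxes; apply/andP.
exists f; last first.
  apply/forallP => -[[r u] ru]; rewrite in_boxes partf /= TG /=.
  have := ru; rewrite in_boxes /= => /andP[ler ltr]; rewrite ler /=.
  case: ex_minnP => v /andP[le_v Pv] min_v; apply/eqP; apply/idP/idP => [lt_c|lt_v].
    rewrite ltnNge; apply/negP => le_vu.
    case/orP: Pv => [|le_c]; first by rewrite leqNgt (leq_ltn_trans le_vu).
    have lt_v := leq_ltn_trans le_vu ltr.
    have le_G := rowT _ _ _ (inlam _ _ le_v lt_v) ru le_vu.
    by have := leq_ltn_trans (leq_trans le_c le_G) lt_c; rewrite ltnn.
  rewrite ltnNge; apply/negP => le_c.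
  by have := min_v u; rewrite /P ler le_c orbT => /(_ isT); lia.
apply/andP; split; last first.
  by apply/includedP => i; rewrite partf; case: ex_minnP => v /andP[].
apply/forallP => i; rewrite -part_fseq partf le_ex andbT.
case: ex_minnP => v /andP[le_v /orP[le_lam|le_c]] _.
  by apply: leq_trans le_lam; move/is_partitionP: lamP.
(* Otherwise rows [i] and [i+1] both have a box in column [v]. The upper one holds at least [c], so
   the lower one would hold a letter above [c]. *)
rewrite leqNgt; apply/negP => lt_v.
have iv : (val i, v) \in boxes lam mu.
  by apply: inlam => //; apply: leq_trans lt_v _; move/is_partitionP: lamP.
have Siv : ((val i).+1, v) \in boxes lam mu.
  by apply: inlam => //; apply: leq_trans le_v; move/is_partitionP: muP.
have := colT _ _ _ iv Siv (ltnSn _); rewrite ltnNge => /negP[].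
apply: leq_trans le_c.
by rewrite -ltnS -[((val i).+1, v)]/(val [` Siv]%fset) -TG ltn_ord.
Qed.

(** If [f i < g i], the box in row [i] and column [f i] belongs to the shape [g] but not to [f]. *)
Lemma sublevel_inj c (T : {ffun boxes lam mu -> 'I_c.+1}) f g :
  inner f -> inner g -> sublevel T f -> sublevel T g -> f = g.
Proof.
wlog: f g / [exists i, f i < g i]%N.
  move=> wl If Ig Tf Tg; have [lt|nlt] := boolP [exists i, f i < g i]%N.
    exact: wl.
  have [lt'|nlt'] := boolP [exists i, g i < f i]%N; first exact/esym/wl.
  apply/ffunP => i; apply/val_inj/eqP; rewrite eqn_leq.
  move: nlt nlt'; rewrite !negb_exists => /forallP/(_ i) + /forallP/(_ i).
  by rewrite -!leqNgt => -> ->.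
move=> /existsP[i lt_fg] If Ig /forallP Tf /forallP Tg.
have [fP muf] := innerP If; have [gP mug] := innerP Ig.
have ib : (val i, val (f i)) \in boxes lam mu.
  have := gP i; have := muf i; rewrite in_boxes !part_fseq /=; lia.
have := Tf [` ib]%fset; rewrite (eqP (Tg _)) !in_boxes /= !part_fseq ltnn lt_fg andbF andbT.
by have := muf i; rewrite part_fseq => ->.
Qed.

Definition fill c (f : {ffun 'I_L -> 'I_B}) (T : {ffun boxes (fseq f) mu -> 'I_c}) :
    {ffun boxes lam mu -> 'I_c.+1} :=
  [ffun b => inord (ext T (val b))].

Lemma val_fill c (f : {ffun 'I_L -> 'I_B}) (T : {ffun boxes (fseq f) mu -> 'I_c}) b :
  fill T b = ext T (val b) :> nat.
Proof. by rewrite ffunE inordK// ltnS ext_le. Qed.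

Lemma boxes_inner f p : inner f -> p \in boxes (fseq f) mu -> p \in boxes lam mu.
Proof.
move=> /innerP[fP _]; rewrite !in_boxes.
by have /andP[_] := fP p.1; lia.
Qed.

Lemma fill_inj c f : inner f -> injective (@fill c f).
Proof.
move=> If T T' eqT; apply/ffunP => e; apply: val_inj.
have eb := boxes_inner If (valP e).
have := val_fill T [` eb]%fset; rewrite eqT val_fill /=.
by rewrite !ext_val.
Qed.

Lemma sublevel_fill c f T : sublevel (@fill c f T) f.
Proof. by apply/forallP => b; rewrite val_fill ext_lt. Qed.

(** The boxes receiving [c] form a horizontal strip: by interlacing, a box of lam/mu above one of
    them lies inside [f] and holds a smaller letter, so columns stay strict. *)
Lemma fill_semistandard c (f : {ffun 'I_L -> 'I_B}) (T : {ffun boxes (fseq f) mu -> 'I_c}) : inner f ->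
  semistandard (fun b => val (fill T b)) = semistandard (fun e => val (T e)).
Proof.
move=> If; have Tval e : val (T e) = ext T (val e) by rewrite ext_val.
apply/(semistandardP (val_fill T))/(semistandardP Tval).
  move=> [rowT colT]; split=> [r u v ru rv|r s u ru su].
    by apply: rowT; exact: boxes_inner If _.
  by apply: colT; exact: boxes_inner If _.
move=> [rowT colT]; have [fP muf] := innerP If.
have fpart : is_partition (fseq f).
  by apply/is_partitionP => i; have := fP i; have := fP i.+1; lia.
split=> [r u v ru rv le_uv|r s u ru su lt_rs].
  have [rv'|/ext_out->] := boolP ((r, v) \in boxes (fseq f) mu); last exact: ext_le.
  apply: rowT => //; move: ru rv rv'; rewrite !in_boxes /=; lia.
have [su'|su'] := boolP ((s, u) \in boxes (fseq f) mu).
  apply: colT => //; move: ru su su'; rewrite !in_boxes /=.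
  by have := part_le fpart (ltnW lt_rs); lia.
rewrite (ext_out T su') ext_lt; move: ru su su'; rewrite !in_boxes /=.
have := part_le lamP lt_rs; have := fP r; lia.
Qed.

Lemma fill_surj c f (T : {ffun boxes lam mu -> 'I_c.+1}) : inner f ->
  sublevel T f -> exists T', @fill c f T' = T.
Proof.
move=> If /forallP Tf.
have lt_c (e : boxes (fseq f) mu) : (T [` boxes_inner If (valP e)]%fset < c)%N.
  by rewrite (eqP (Tf _)) /= (valP e).
exists [ffun e => Ordinal (lt_c e)]; apply/ffunP => b; apply: val_inj.
rewrite [LHS]val_fill; have [bf|bf] := boolP (val b \in boxes (fseq f) mu).
  rewrite -[val b]/(val [` bf]%fset) ext_val ffunE /=; congr (val (T _)).
  exact: val_inj.
rewrite ext_out//; apply/eqP; rewrite eqn_leq -[X in _ && X]ltnS ltn_ord andbT.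
by rewrite leqNgt (eqP (Tf b)).
Qed.

(** Branching rule: tableaux are sorted by the shape [f] occupied by the letters below [c]; the
    letter [c] then fills the horizontal strip between [f] and [lam]. *)
Lemma tableau_sumS c :
  tableau_sum lam mu c.+1 =
  \sum_(f : {ffun 'I_L -> 'I_B} | inner f)
    (\prod_(i < L) x c ^+ (part lam i - f i)) * tableau_sum (fseq f) mu c.
Proof.
(* [f0] is a mere default: on semistandard tableaux the [pick] in [shape] succeeds. *)
pose f0 : {ffun 'I_L -> 'I_B} := [ffun=> Ordinal (leq_ltn_trans (leq0n _) ltB)].
pose shape (T : {ffun boxes lam mu -> 'I_c.+1}) :=
  odflt f0 [pick f | inner f && sublevel T f].
have shapeP (T : {ffun boxes lam mu -> 'I_c.+1}) :
    semistandard (fun b => val (T b)) -> inner (shape T) && sublevel T (shape T).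
  move=> ssT; rewrite /shape; case: pickP => [f //|none].
  by have [f If Tf] := sublevel_exists ssT; have := none f; rewrite If Tf.
rewrite /tableau_sum (partition_big shape inner) => [|T /shapeP/andP[]//].
apply: eq_bigr => f If.
rewrite (eq_bigl (fun T : {ffun boxes lam mu -> 'I_c.+1} =>
  semistandard (fun b => val (T b)) && sublevel T f)); last first.
  move=> T; case ssT: semistandard => //=; have /andP[IT sT] := shapeP T ssT.
  by apply/eqP/idP => [<-//|sf]; apply: sublevel_inj sT sf.
rewrite (reindex_omap (@fill c f) (fun T => [pick T' | fill T' == T])); last first.
  move=> T /andP[_ /(fill_surj If)[T' fT']].
  by case: pickP => [T'' /eqP <-//|/(_ T')]; rewrite fT' eqxx.
rewrite mulr_sumr; apply: eq_big => [T|T _].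
  rewrite fill_semistandard// sublevel_fill andbT.
  case: pickP => [T' /eqP/(fill_inj If) ->|/(_ T)]; first by rewrite eqxx andbT.
  by rewrite eqxx.
have [fP muf] := innerP If.
rewrite (eq_bigr (fun b => x (ext T (val b)))) => [|b _]; last by rewrite val_fill.
rewrite (prod_boxes _ (fun p => x (ext T p)) szlam).
rewrite [in RHS](eq_bigr (fun e => x (ext T (val e)))) => [|e _]; last by rewrite ext_val.
rewrite (prod_boxes _ (fun p => x (ext T p)) (_ : (_ <= L)%N)) ?size_fseq//.
rewrite -big_split; apply: eq_bigr => i _ /=.
have := fP i; have := muf i; rewrite part_fseq => le_mui /andP[_ le_i].
(* Row [i] splits at column [f i]; from there on every letter is [c]. *)
rewrite (big_cat_nat le_mui le_i) /= mulrC; congr (_ * _).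
rewrite [LHS]big_nat (eq_bigr (fun=> x c)) => [|v /andP[le_v _]]; last first.
  by rewrite ext_out// in_boxes /= part_fseq; lia.
by rewrite -big_nat prodr_const_nat.
Qed.

End Restriction.

Lemma tableau_sum0 L lam mu : (size lam <= L)%N ->
  included mu lam ->
  tableau_sum lam mu 0 = [forall i : 'I_L, part lam i == part mu i]%:R.
Proof.
move=> szlam /includedP le_mu; case: (boolP [forall i, _]) => [/forallP eq_lam|].
  have noT (b : boxes lam mu) : False.
    case: b => [[r u]]; rewrite in_boxes /=.
    have [lt_r|ge_r] := ltnP r L; first by have /eqP := eq_lam (Ordinal lt_r); rewrite /=; lia.
    by rewrite [part lam r]/part nth_default//; lia.
  have T0 : {ffun boxes lam mu -> 'I_0} by apply: finfun => b; case: (noT b).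
  rewrite /tableau_sum (big_pred1 T0) => [|T].
    by rewrite big1// => b; case: (noT b).
  apply/forallP/eqP => [_|_ b]; last by case: (noT b).
  by apply/ffunP => b; case: (noT b).
rewrite negb_forall => /existsP[i ne_i].
rewrite /tableau_sum big1// => T _.
have ib : (val i, part mu i) \in boxes lam mu.
  by have := le_mu i; rewrite in_boxes /= leqnn /= ltn_neqAle eq_sym ne_i.
by case: (T [` ib]%fset).
Qed.

(** The entry [tker c a b] is h_{a-b} of the first [c] variables, zero for a < b. *)
Fixpoint tker c : nat -> nat -> A :=
  if c is c'.+1 then step (x c') (tker c') else fun a b => (a == b)%:R.

(** Every [f] interlacing with [lam] lies inside [lam], so it does not contain [mu] either. Once all
    variables are removed, two shapes differing in the first [L] rows remain. *)
Lemma jacobi_trudi_not_included c L lam mu :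
    is_partition lam -> is_partition mu -> (size lam <= L)%N ->
    part mu L = 0%N -> ~~ included mu lam ->
  jacobi_trudi L (tker c) lam mu = 0.
Proof.
elim: c lam => [|c IH] lam lamP muP szlam muL nle_mu.
  rewrite jacobi_trudi_delta//; case: forallP => // eq_lam.
  case/includedP: nle_mu => i; have [lt_i|ge_i] := ltnP i L.
    by rewrite -(eqP (eq_lam (Ordinal lt_i))).
  by have := part_le muP ge_i; rewrite muL leqn0 => /eqP->.
rewrite (jacobi_trudi_step _ _ _ lamP szlam (ltnSn _)) big1// => f fI.
have /forallP fP := fI.
have fle i : (part (fseq f) i <= part lam i)%N.
  have [lt_i|ge_i] := ltnP i L; last by rewrite /part nth_default ?size_fseq.
  by have := fP (Ordinal lt_i); rewrite -part_fseq => /andP[].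
rewrite IH ?mulr0 ?size_fseq ?(interlace_partition fI)//.
apply: contra nle_mu => /includedP muf; apply/includedP => i.
exact: leq_trans (muf i) (fle i).
Qed.

(** Both sides obey the same recursion in [c], except that the determinant also sums over [f] not
    containing [mu]; those terms vanish. *)
Lemma tableau_sum_jacobi_trudi c L lam mu :
    is_partition lam -> is_partition mu -> (size lam <= L)%N ->
    included mu lam ->
  tableau_sum lam mu c = jacobi_trudi L (tker c) lam mu.
Proof.
elim: c lam => [|c IH] lam lamP muP szlam le_mu.
  by rewrite (tableau_sum0 szlam)// jacobi_trudi_delta.
rewrite (tableau_sumS lamP muP szlam (ltnSn _))//.
rewrite (jacobi_trudi_step _ _ _ lamP szlam (ltnSn _)).
rewrite [RHS](bigID (fun f : {ffun _ -> _} => included mu (fseq f))) /=.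
rewrite [X in _ = _ + X]big1 ?addr0.
  by apply: eq_bigr => f /andP[/interlace_partition fP le_f]; rewrite IH ?size_fseq.
move=> f /andP[/interlace_partition fP nle_f].
rewrite jacobi_trudi_not_included ?mulr0 ?size_fseq//.
apply/eqP; rewrite -leqn0; apply: leq_trans (includedP _ _ le_mu L) _.
by rewrite /part nth_default.
Qed.

(** Removing a variable removes at most one row, because [f] at index [c] is at least
    [part lam c.+1]. A shape with more than [c] rows is therefore still nonempty when no variables
    are left. *)
Lemma jacobi_trudi_tker_long c L lam :
    is_partition lam -> (size lam <= L)%N -> (c < L)%N -> (0 < part lam c)%N ->
  jacobi_trudi L (tker c) lam [::] = 0.
Proof.
elim: c lam => [|c IH] lam lamP szlam lt_c lam_gt0.
  rewrite jacobi_trudi_delta//; case: forallP => // /(_ (Ordinal lt_c)).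
  by rewrite /= [part [::] _]/part /= => /eqP e; rewrite e in lam_gt0.
rewrite (jacobi_trudi_step _ _ _ lamP szlam (ltnSn _)) big1// => f fP.
rewrite IH ?mulr0 ?size_fseq ?(interlace_partition fP)// ?(ltnW lt_c)//.
move/forallP/(_ (Ordinal (ltnW lt_c))): fP; rewrite -part_fseq /= => /andP[+ _].
exact: leq_trans lam_gt0.
Qed.

End Tableaux.

(** * Removing a row from a Toeplitz determinant *)

Section Toeplitz.
Variables (A : comNzRingType) (h : nat -> A).

Definition toeplitz a b : A := if (b <= a)%N then h (a - b) else 0.

(** Substituting d = a - c turns the new variable into shifts of the column index. Terms with b + d
    > a vanish, so one bound [M] can serve all rows. *)
Lemma step_toeplitz (S : comNzRingType) (phi : {rmorphism A -> S}) y a b M :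
    (a < M)%N ->
  step y (fun a b => phi (toeplitz a b)) a b =
  \sum_(0 <= d < M) y ^+ d * phi (toeplitz a (b + d)).
Proof.
move=> lt_a; rewrite (@big_cat_nat _ _ _ a.+1)//= [X in _ = _ + X]big_nat.
rewrite [X in _ = _ + X]big1 ?addr0 => [|d /andP[lt_d _]]; last first.
  by rewrite /toeplitz leqNgt (leq_trans lt_d) ?leq_addl// rmorph0 mulr0.
rewrite /step big_nat_rev !big_nat; apply: eq_bigr => d /andP[_ lt_d].
rewrite add0n subSS subKn//; congr (_ * phi _); rewrite /toeplitz.
have -> : (b <= a - d)%N = (b + d <= a)%N by lia.
by case: ifP => // _; congr h; lia.
Qed.

(** The two sums cancel except for the term d = 0; this is the column analogue of [stepS]. *)
Lemma step_toeplitzB (S : comNzRingType) (phi : {rmorphism A -> S}) y a b :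
  step y (fun a b => phi (toeplitz a b)) a b -
    y * step y (fun a b => phi (toeplitz a b)) a b.+1 = phi (toeplitz a b).
Proof.
rewrite (step_toeplitz phi y b (leqnSn a.+1)) (step_toeplitz phi y b.+1 (ltnSn a)).
rewrite big_nat_recl// expr0 mul1r addn0 mulr_sumr -addrA -sumrB.
rewrite big1_seq ?addr0// => d _.
by rewrite exprS mulrA addnS addSn subrr.
Qed.

(** Subtracting [y] times the preceding column removes [y] from every column but the first. The
    first is a sum over [d], and linearity in it produces the inner shapes [[:: d]]. *)
Lemma jacobi_trudi_step_col (S : comNzRingType) (phi : {rmorphism A -> S})
    y L lam M : is_partition lam -> (part lam 0 + L < M)%N ->
  jacobi_trudi L.+1 (step y (fun a b => phi (toeplitz a b))) lam [::] =
  \sum_(0 <= d < M) y ^+ d * phi (jacobi_trudi L.+1 toeplitz lam [:: d]).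
Proof.
move=> lamP ltM.
pose V : 'M[S]_L.+1 := \matrix_(j', j) ((j' == j)%:R - (j'.+1 == j)%:R * y).
have detV : \det V = 1 by exact: det_superdiagonal.
rewrite {1}/jacobi_trudi; set W := (X in \det X = _).
have -> : \det W = \det (W *m V) by rewrite det_mulmx detV mulr1.
pose Z d : 'M[A]_L.+1 := \matrix_(i, j)
  toeplitz (part lam i + (L.+1 - i.+1)) (part [:: d] j + (L.+1 - j.+1)).
have WV i j : (W *m V) i j = if j == ord0 then
    \sum_(0 <= d < M) y ^+ d * phi (Z d i ord0) else phi (Z 0 i j).
  rewrite !mxE; under eq_bigr => j' _ do rewrite !mxE mulrBr.
  rewrite sumrB (bigD1 j)//= eqxx mulr1 [X in _ + X - _]big1 ?addr0; last first.
    by move=> j' /negbTE ->; rewrite mulr0.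
  have lt_a : (part lam i + (L.+1 - i.+1) < M)%N.
    by have := part_le lamP (leq0n i); lia.
  have [->|nz_j] := eqVneq.
    rewrite big1 ?subr0 => [|j' _]; last by rewrite mul0r mulr0.
    rewrite (step_toeplitz _ _ _ lt_a); apply: eq_bigr => d _; rewrite mxE.
    by congr (_ * phi (toeplitz _ _)); rewrite /part /=; lia.
  have lt_j : (j.-1 < L.+1)%N by have := ltn_ord j; lia.
  have j_gt0 : (0 < j)%N by rewrite lt0n.
  rewrite (bigD1 (Ordinal lt_j))//= prednK// eqxx big1 ?addr0; last first.
    move=> j' ne_j'; have -> : (j'.+1 == j :> nat) = false; last by rewrite mul0r mulr0.
    by apply/negbTE; apply: contra ne_j' => /eqP e; apply/eqP/val_inj; rewrite /= -e.
  rewrite part_singleton// add0n [(part [::] _)]/part nth_nil add0n.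
  have -> : (L.+1 - j = (L.+1 - j.+1).+1)%N by have := ltn_ord j; lia.
  rewrite mul1r [_ * y]mulrC -[RHS](step_toeplitzB phi y).
  by congr (_ - _ * step _ _ _ _); rewrite /part nth_nil.
rewrite (expand_det_col _ ord0).
under [RHS]eq_bigr => d _.
  rewrite /jacobi_trudi (expand_det_col _ ord0) rmorph_sum mulr_sumr.
  over.
rewrite exchange_big; apply: eq_bigr => i _; rewrite WV eqxx mulr_suml.
apply: eq_bigr => d _; rewrite -/(Z d) rmorphM mulrA; congr (_ * _).
rewrite /cofactor rmorphM rmorph_sign -det_map_mx; congr (_ * \det _).
apply/matrixP => i' j'; rewrite [LHS]mxE [LHS]mxE WV !mxE.
by rewrite eq_sym (negbTE (neq_lift _ _)).
Qed.

(* An additional variable ['X] can be removed from the determinant of [lam] by row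
   or by column operations; compare the coefficients of ['X^m]. *)
Lemma jacobi_trudi_dual_pieri L B lam m :
    is_partition lam -> (size lam <= L.+1)%N -> (part lam 0 < B)%N ->
  jacobi_trudi L.+1 toeplitz lam [:: m] =
  \sum_(f : {ffun 'I_L.+1 -> 'I_B} | interlace lam f &&
           (\sum_(i < L.+1) (part lam i - f i) == m)%N)
     jacobi_trudi L.+1 toeplitz (fseq f) [::].
Proof.
(* [M] also exceeds [m], so that the term of ['X^m] occurs in the column sum. *)
move=> lamP szlam ltB; set M := (part lam 0 + L + m).+1.
have ltM : (part lam 0 + L < M)%N by rewrite /M; lia.
have := jacobi_trudi_step_col (@polyC A) 'X lamP ltM.
rewrite (jacobi_trudi_step _ _ _ lamP szlam ltB) => /(congr1 (coefp m)).
rewrite !raddf_sum /= [RHS](bigD1_seq m) ?iota_uniq//=; last first.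
  by rewrite mem_index_iota; lia.
rewrite ['X^m * _]mulrC coefCM coefXn eqxx mulr1 [X in _ + X]big1 ?addr0 => [<-|d /negbTE ne_d]; last first.
  by rewrite ['X^d * _]mulrC coefCM coefXn eq_sym ne_d mulr0.
rewrite [RHS]big_mkcondr; apply: eq_bigr => f _.
have -> : jacobi_trudi L.+1 (fun a b => (toeplitz a b)%:P) (fseq f) [::] =
   (jacobi_trudi L.+1 toeplitz (fseq f) [::])%:P.
  rewrite -[RHS]det_map_mx; congr (\det _).
  by apply/matrixP => i j; rewrite !mxE.
rewrite -expr_sum ['X^_ * _]mulrC coefCM coefXn eq_sym.
by case: eqP; rewrite ?mulr1 ?mulr0.
Qed.

(** Laplace expansion along the first row. Deleting column 0 leaves the empty inner shape. Deleting
    column [i.+1] raises the inner parts of the columns before it by one, relative to the smaller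
    matrix, which gives the hook. *)
Lemma jacobi_trudi_expand k lam N j : (j <= N)%N ->
  jacobi_trudi k.+1 toeplitz (N :: lam) [:: (N - j)%N] =
  h j * jacobi_trudi k toeplitz lam [::] +
  \sum_(i < k) (-1) ^+ i.+1 * h (N + i.+1)%N *
     jacobi_trudi k toeplitz lam ((N - j).+1 :: nseq i 1%N).
Proof.
move=> le_j; rewrite {1}/jacobi_trudi (expand_det_row _ ord0) big_ord_recl.
congr (_ + _).
  rewrite !mxE /cofactor addn0 expr0 mul1r /jacobi_trudi.
  congr (_ * _); last congr (\det _).
    rewrite /toeplitz /part /= subSS subn0 leq_add2r leq_subr.
    by congr h; lia.
  apply/matrixP => i i'; rewrite !mxE !lift0 !subSS.
  by rewrite [part [:: _] _.+1]/part /= nth_nil [part [::] _]/part nth_nil.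
apply: eq_bigr => l _; rewrite !mxE /cofactor mulrCA mulrA /jacobi_trudi.
congr (_ * _ * _); last congr (\det _).
  rewrite lift0 /toeplitz /part /= nth_nil; have := ltn_ord l => lt_l.
  by rewrite ifT; [congr h|]; lia.
apply/matrixP => i i'; rewrite !mxE !lift0 !subSS; congr (toeplitz _ _).
have := ltn_ord l; have := ltn_ord i' => lt_i' lt_l.
rewrite /= /bump /=; case: (val i') lt_i' => [|r] lt_r /=; first by rewrite /part /=; lia.
rewrite part_singleton; last by lia.
by rewrite /part /= nth_nseq; case: ltnP => le_l; lia.
Qed.

End Toeplitz.

(** * Schur polynomials in k variables *)

Section Evaluation.
Variables (R : comNzRingType) (k : nat).

(** Indexed by all naturals, so that [tker] can add the variables one at a time. *)
Definition mvar c : {mpoly R[k]} := if insub c is Some i then 'X_i else 0.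

Lemma mvar_ord (i : 'I_k) : mvar i = 'X_i.
Proof. by rewrite /mvar valK. Qed.

Lemma mcoeffXM (i : 'I_k) (p : {mpoly R[k]}) m :
  ('X_i * p)@_m = if (0 < m i)%N then p@_(m - U_(i))%MM else 0.
Proof.
rewrite mulrC; case: ifP => [m_gt0|m_eq0].
  by rewrite -{1}[m](@submK _ U_(i)%MM) ?lep1mP -?lt0n// addmC mcoeffMX.
rewrite mcoeffM big1// => -[m1 m2] /= /eqP em.
rewrite mcoeffX; case: eqP => [e2|_]; last by rewrite mulr0.
have /mnmP/(_ i) := em; rewrite mnmDE -e2 mnm1E eqxx => mi.
by move: m_eq0; rewrite mi addn1.
Qed.

(** By [stepS], a monomial without the newest variable comes only from the summand in fewer
    variables, any other only from the multiple of the newest variable. Writing [mdeg m + b == a]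
    also covers a < b. *)
Lemma mcoeff_tker c a b (m : 'X_{1..k}) : (c <= k)%N ->
  (tker mvar c a b)@_m =
  ((mdeg m + b == a)%N && [forall i : 'I_k, (c <= i) ==> (m i == 0)]%N)%:R.
Proof.
elim: c a m => [|c IH] a m le_c /=.
  rewrite mcoeffMn mcoeff1 -mulrnA mulnb; congr (nat_of_bool _)%:R.
  have -> : [forall i : 'I_k, (0 <= i)%N ==> (m i == 0%N)] = (m == 0%MM).
    apply/forallP/eqP => [m0|-> i]; last by rewrite mnm0E.
    by apply/mnmP => i; rewrite mnm0E (eqP (m0 i)).
  by case: eqP => [->|_]; rewrite ?andbF// mdeg0 add0n !andbT eq_sym.
pose ic : 'I_k := Ordinal le_c.
have supp (m' : 'X_{1..k}) : [forall i : 'I_k, (c <= i) ==> (m' i == 0)]%N =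
    (m' ic == 0%N) && [forall i : 'I_k, (c.+1 <= i) ==> (m' i == 0)]%N.
  apply/forallP/andP => [m0|[mc0 /forallP m0] i].
    split; first by have := m0 ic; rewrite leqnn.
    by apply/forallP => i; apply/implyP => /ltnW; apply/implyP.
  rewrite leq_eqVlt; apply/implyP => /orP[/eqP e|]; last exact/implyP.
  by rewrite (_ : i = ic)//; apply: val_inj.
elim: a m => [|a IHa] m.
  rewrite /step big_nat1 expr0 mul1r IH 1?ltnW// supp; congr (nat_of_bool _)%:R.
  have [mc0|nz_mc] := eqVneq (m ic) 0%N; first by [].
  rewrite addn_eq0 mdeg_eq0; case: eqP => [m0|]; rewrite ?andbF//.
  by rewrite m0 mnm0E in nz_mc.
have XM p : (mvar c * p)@_m = ('X_ic * p)@_m by rewrite -mvar_ord.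
rewrite stepS mcoeffD IH 1?ltnW// XM mcoeffXM IHa supp.
case: posnP => [_|mc_gt0]; first by rewrite addr0.
rewrite andbF add0r; congr (nat_of_bool (_ && _))%:R.
  rewrite -{2}[m](@submK _ U_(ic)%MM) ?lep1mP -?lt0n// mdegD mdeg1 addn1 addSn.
  by rewrite eqSS.
apply: eq_forallb => i; case: ltnP => //= lt_i.
by rewrite mnmBE mnm1E (_ : ic == i = false) ?subn0//; apply/negbTE; rewrite neq_ltn /= lt_i.
Qed.

Lemma mcoeff_hsym r (m : 'X_{1..k}) : (hsym R k r)@_m = (mdeg m == r)%:R.
Proof.
rewrite /hsym raddf_sum; have [em|ne_m] := eqVneq (mdeg m) r.
  have lt_m : (mdeg m < r.+1)%N by rewrite em.
  rewrite (bigD1 (BMultinom lt_m)) /= ?em// mcoeffX eqxx big1 ?addr0// => t /andP[_ ne_t].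
  rewrite mcoeffX; case: eqP => // e; case/eqP: ne_t; exact: val_inj.
rewrite big1// => t /eqP et; rewrite /= mcoeffX; case: eqP => // e.
by rewrite -e et eqxx in ne_m.
Qed.

Lemma hsym_sym r : hsym R k r \is symmetric.
Proof.
apply/issymP => s; apply/mpolyP => m.
by rewrite mcoeff_sym !mcoeff_hsym mdeg_mperm.
Qed.

Lemma tker_mvar : tker mvar k =2 toeplitz (hsym R k).
Proof.
move=> a b; apply/mpolyP => m; rewrite mcoeff_tker// /toeplitz.
have -> : [forall i : 'I_k, (k <= i) ==> (m i == 0)]%N.
  by apply/forallP => i; rewrite leqNgt ltn_ord.
rewrite andbT; case: leqP => [le_ba|lt_ab].
  by rewrite mcoeff_hsym -[in RHS](eqn_add2r b) subnK.
by rewrite mcoeff0 (_ : _ == _ = false)//; lia.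
Qed.

Lemma schur_poly_tableau_sum lam : schur_poly R k lam = tableau_sum mvar lam [::] k.
Proof. by apply: eq_bigr => T _; apply: eq_bigr => b _; rewrite mvar_ord. Qed.

Lemma jacobi_trudi_sym L lam mu :
  jacobi_trudi L (toeplitz (hsym R k)) lam mu \is symmetric.
Proof.
apply: rpred_sum => s _; apply: rpredM; first by rewrite rpred_sign.
apply: rpred_prod => i _; rewrite mxE /toeplitz.
by case: ifP => _; [apply: hsym_sym | apply: rpred0].
Qed.

Lemma mcoeff_tableau_sum lam mu m : (tableau_sum mvar lam mu k)@_m =
  #|[set T : {ffun boxes lam mu -> 'I_k} | semistandard (fun b => val (T b)) &
     [forall i : 'I_k, #|[set b | T b == i]| == m i]]|%:R.
Proof.
rewrite raddf_sum -sum1_card natr_sum /= [RHS](eq_bigl (fun T : {ffun _ -> _} =>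
  semistandard (fun b => val (T b)) && [forall i : 'I_k, #|[set b | T b == i]| == m i]));
  last by move=> T; rewrite inE.
rewrite [RHS]big_mkcondr; apply: eq_bigr => T _.
under eq_bigr => b _ do rewrite mvar_ord.
rewrite mprodXE mcoeffX -[if _ then _ else _]/(if _ then 1 else 0).
have -> : (\sum_b U_(T b)%MM == m)%MM = [forall i : 'I_k, #|[set b | T b == i]| == m i].
  have cnt i : (\sum_b U_(T b))%MM i = #|[set b | T b == i]|.
    rewrite mnm_sumE -sum1_card big_mkcond [RHS]big_mkcond /=.
    by apply: eq_bigr => b _; rewrite mnm1E inE; case: eqP.
  apply/eqP/forallP => [<- i|eq_m]; first by rewrite cnt.
  by apply/mnmP => i; rewrite cnt (eqP (eq_m i)).
by case: ifP.
Qed.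

Lemma monomial_of_ord (m : 'X_{1..k}) (i : 'I_k) : monomial_of m i = m i.
Proof. by rewrite fsfunE !inE mem_iota ltn_ord /= (mnm_nth 0%N). Qed.

Lemma finsupp_monomial_of (m : 'X_{1..k}) i : i \in finsupp (monomial_of m) -> (i < k)%N.
Proof.
rewrite mem_finsupp fsfunE; case: ifP => [|_]; last by rewrite eqxx.
by rewrite !inE mem_iota.
Qed.

(** A tableau of content [m] has all its entries in the support of [m], so enlarging the alphabet to
    ['I_k] is a bijection between the tableaux counted on both sides. *)
Lemma mcoeff_skew_schur lam mu (m : 'X_{1..k}) : included mu lam ->
  skew_schur R lam mu (monomial_of m) = (tableau_sum mvar lam mu k)@_m.
Proof.
move=> le_mu; rewrite mcoeff_tableau_sum /skew_schur le_mu; congr (_ %:R).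
set S := finsupp (monomial_of m).
pose inc (i : S) : 'I_k := Ordinal (finsupp_monomial_of (valP i)).
pose g (T : {ffun boxes lam mu -> S}) : {ffun boxes lam mu -> 'I_k} :=
  [ffun b => inc (T b)].
have inc_inj : injective inc by move=> i i' [/val_inj].
have g_inj : injective g.
  by move=> T T' /ffunP eqT; apply/ffunP => b; have := eqT b; rewrite !ffunE => /inc_inj.
rewrite -(card_imset _ g_inj); apply: eq_card => T; rewrite inE.
have gcard (T' : {ffun boxes lam mu -> S}) i :
    #|[set b | g T' b == inc i]| = #|[set b | T' b == i]|.
  by apply: eq_card => b; rewrite !inE ffunE (inj_eq inc_inj).
have g0 (T' : {ffun boxes lam mu -> S}) (i : 'I_k) :
    val i \notin S -> #|[set b | g T' b == i]| = 0%N.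
  move=> iS; apply: eq_card0 => b; rewrite !inE ffunE; apply/negbTE.
  by apply: contra iS => /eqP <-; exact: valP (T' b).
have ssg (T' : {ffun boxes lam mu -> S}) :
    semistandard (fun b => val (g T' b)) = semistandard (fun b => val (T' b)).
  by apply: eq_forallb => b; apply: eq_forallb => b'; rewrite !ffunE.
apply/imsetP/andP => [[T' + ->]|[ssT /forallP contT]].
  rewrite inE ssg => /andP[ssT' /forallP contT']; split=> //.
  apply/forallP => i; have [iS|iS] := boolP (val i \in S).
    have -> : i = inc [` iS]%fset by apply: val_inj.
    by rewrite gcard (eqP (contT' _)) -monomial_of_ord.
  by rewrite g0// -monomial_of_ord eq_sym; move: iS; rewrite mem_finsupp negbK.
have inS b : val (T b) \in S.
  rewrite mem_finsupp monomial_of_ord -(eqP (contT (T b))) -lt0n.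
  by apply/card_gt0P; exists b; rewrite inE.
pose T' : {ffun boxes lam mu -> S} := [ffun b => [` inS b]%fset].
have gT' : g T' = T by apply/ffunP => b; rewrite !ffunE; apply: val_inj.
exists T'; rewrite ?gT'// inE -ssg gT' ssT; apply/forallP => i.
by rewrite -gcard gT' (eqP (contT _)) -monomial_of_ord.
Qed.

Lemma skew_schur_bounded lam mu : bounded_degree (skew_schur R lam mu).
Proof.
exists #|{: boxes lam mu}| => m lt_m; rewrite /skew_schur; case: ifP => // _.
rewrite eq_card0// => T; rewrite !inE; apply/negbTE/andP => -[_ /forallP contT].
move: lt_m; rewrite /mondeg big_seq_fsetE /=.
under eq_bigr => i _ do rewrite -(eqP (contT i)) -sum1_card.
rewrite -sum1_card (partition_big T xpredT)//=.
rewrite (eq_bigr (fun i => \sum_(b in [set b | T b == i]) 1)%N) ?ltnn// => i _.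
by apply: eq_bigl => b; rewrite inE.
Qed.

Lemma evalk_skew_schur L lam mu : is_partition lam -> is_partition mu ->
    (size lam <= L)%N -> part mu L = 0%N ->
  evalk k (skew_schur R lam mu) = jacobi_trudi L (toeplitz (hsym R k)) lam mu.
Proof.
move=> lamP muP szlam muL; rewrite -(eq_jacobi_trudi _ tker_mvar (frefl _) (frefl _)).
apply/mpolyP => m; rewrite evalkE; last exact: skew_schur_bounded.
have [le_mu|nle_mu] := boolP (included mu lam).
  by rewrite mcoeff_skew_schur// (tableau_sum_jacobi_trudi _ _ lamP muP szlam).
by rewrite jacobi_trudi_not_included// mcoeff0 /skew_schur (negbTE nle_mu).
Qed.

Lemma schur_poly_jacobi_trudi L lam : is_partition lam -> (size lam <= L)%N ->
  schur_poly R k lam = jacobi_trudi L (toeplitz (hsym R k)) lam [::].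
Proof.
move=> lamP szlam; rewrite schur_poly_tableau_sum (tableau_sum_jacobi_trudi _ _ lamP _ szlam)//.
exact: (eq_jacobi_trudi _ tker_mvar (frefl _) (frefl _)).
Qed.

End Evaluation.

(** * The truncated Pieri rule and multiplication modulo I *)

(** Interlacing with (N, lam), where N = n - k, bounds the first part of mu by N and makes mu/lam a
    horizontal strip; removing N - j boxes from (N, lam) gives it size j. *)
Lemma truncated_pieri (R : comNzRingType) k n j (lam : k.-tuple 'I_(n - k).+1) :
    lam \in Pkn k n -> (j <= n - k)%N ->
  jacobi_trudi k.+1 (toeplitz (hsym R k)) ((n - k)%N :: parts lam) [:: (n - k - j)%N] =
  \sum_(mu in Pkn k n | horizontal_strip j (parts mu) (parts lam))
    schur_poly R k (parts mu).
Proof.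
set N := (n - k)%N; rewrite inE => lamP le_j.
have le_N (mu : k.-tuple 'I_N.+1) i : (part (parts mu) i <= N)%N.
  have [lt_i|ge_i] := ltnP i k; last by rewrite /part nth_default ?size_parts.
  by rewrite -[i]/(val (Ordinal lt_i)) part_parts -ltnS ltn_ord.
have lamk0 (mu : k.-tuple 'I_N.+1) : part (parts mu) k = 0%N.
  by rewrite /part nth_default ?size_parts.
have LamP : is_partition (N :: parts lam).
  by apply/is_partitionP => -[|i]; [exact: (le_N lam 0%N) | exact: (is_partitionP _ lamP i)].
have szLam : (size (N :: parts lam) <= k.+1)%N by rewrite /= size_parts.
rewrite (@jacobi_trudi_dual_pieri _ _ _ N.+1 _ _ LamP szLam (ltnSn _)).
(* If the last of the [k.+1] rows is nonempty, the determinant in [k] variables vanishes. *)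
rewrite (bigID (fun f : {ffun 'I_k.+1 -> 'I_N.+1} => f ord_max == ord0)) /=.
rewrite [X in _ + X]big1 ?addr0 => [|f /andP[/andP[fP _] f_gt0]]; last first.
  rewrite -(eq_jacobi_trudi _ (tker_mvar R k) (frefl _) (frefl _)).
  rewrite jacobi_trudi_tker_long ?size_fseq ?(interlace_partition fP)//.
  by rewrite -[k]/(val (@ord_max k)) part_fseq lt0n.
pose h (mu : k.-tuple 'I_N.+1) : {ffun 'I_k.+1 -> 'I_N.+1} :=
  [ffun i : 'I_k.+1 => inord (part (parts mu) i)].
pose h' (f : {ffun 'I_k.+1 -> 'I_N.+1}) : k.-tuple 'I_N.+1 :=
  [tuple f (widen_ord (leqnSn k) i) | i < k].
have hE mu : part (fseq (h mu)) =1 part (parts mu).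
  move=> i; have [lt_i|ge_i] := ltnP i k.+1; last first.
    by rewrite /part !nth_default ?size_parts ?size_fseq// ltnW.
  by rewrite -[i]/(val (Ordinal lt_i)) part_fseq ffunE /= inordK// ltnS le_N.
rewrite (reindex_onto h h') /=; last first.
  move=> f /andP[_ /eqP f0]; apply/ffunP => i; rewrite ffunE; apply: val_inj.
  rewrite /= inordK ?ltnS ?le_N//.
  case: (unliftP ord_max i) => [i' ->|->].
    rewrite lift_max part_parts tnth_mktuple; congr (val (f _)).
    by apply: val_inj; rewrite [RHS]lift_max.
  by rewrite f0 lamk0.
apply: eq_big => [mu|mu /andP[/andP[/andP[hP _] _] _]]; last first.
  have muP : is_partition (parts mu).
    by apply/is_partitionP => i; rewrite -!hE; apply/is_partitionP/(interlace_partition hP).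
  rewrite (@schur_poly_jacobi_trudi _ _ k.+1)// ?size_parts//.
  by apply: eq_jacobi_trudi => // i; rewrite hE.
have -> : h' (h mu) == mu.
  apply/eqP/eq_from_tnth => i; rewrite tnth_mktuple ffunE; apply: val_inj.
  by rewrite /= inordK ?ltnS ?le_N// part_parts.
have -> : h mu ord_max == ord0.
  by rewrite -(inj_eq val_inj) -[val _]part_fseq hE /= lamk0.
rewrite !andbT inE.
(* Interlacing makes the truncated differences exact, so they and the parts of [mu] add up to the
   size of (N, lam). *)
have le_sum : interlace (N :: parts lam) (h mu) ->
    ((\sum_(i < k.+1) (part (N :: parts lam) i - h mu i) == N - j) =
     (sumn (parts mu) == sumn (parts lam) + j))%N.
  move=> /forallP hP.
  have e : (\sum_(i < k.+1) (part (N :: parts lam) i - h mu i) + sumn (parts mu) =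
      N + sumn (parts lam))%N.
    rewrite (@sumn_part k.+1) ?size_parts// -[RHS]/(sumn (N :: parts lam)).
    rewrite (@sumn_part k.+1)// -big_split; apply: eq_bigr => i _ /=.
    by rewrite -hE part_fseq subnK//; case/andP: (hP i).
  by apply/eqP/eqP; lia.
apply/andP/andP => [[hP]|[muP /(horizontal_stripP _ muP lamP)[le_mu [il e]]]].
  have muP : is_partition (parts mu).
    by apply/is_partitionP => i; rewrite -!hE; apply/is_partitionP/(interlace_partition hP).
  rewrite le_sum// => /eqP e; split=> //; apply/horizontal_stripP => //.
  move/forallP: hP => hP; split; [|split=> //] => i.
    have [lt_i|ge_i] := ltnP i k.+1.
      by have := hP (Ordinal lt_i); rewrite -part_fseq hE => /andP[].
    by rewrite /part nth_default ?size_parts// ltnW.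
  have [lt_i|ge_i] := ltnP i.+1 k.+1.
    by have := hP (Ordinal lt_i); rewrite -part_fseq hE => /andP[].
  by rewrite /part nth_default ?size_parts// ltnW.
have hP : interlace (N :: parts lam) (h mu).
  apply/forallP => i; rewrite -part_fseq hE; apply/andP; split; first exact: le_mu.
  case: (val i) => [|i']; [exact: (le_N mu 0%N) | exact: (il i')].
by rewrite le_sum// e.
Qed.

Theorem theorem10p5 (R : comNzRingType) (k n : nat) (hkn : (k <= n)%N)
    (a : 'I_k -> R)
    (perp : series R -> series R -> series R) (hperp : is_skewing perp)
    (lam : k.-tuple 'I_(n - k).+1) (hlam : lam \in Pkn k n)
    (j : nat) (hj : (j <= n - k)%N) :
  eq_mod_I n a
    (schur_poly R k (parts lam) * hsym R k j)
    (\sum_(mu in Pkn k n | horizontal_strip j (parts mu) (parts lam))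
        schur_poly R k (parts mu)
     - \sum_(i < k) (-1) ^+ i.+1 *:
         (a i *: evalk k (perp (schur R ((n - k - j).+1 :: nseq i 1%N))
                               (schur R (parts lam))))).
Proof.
have lamP : is_partition (parts lam) by move: hlam; rewrite inE.
pose hook i := (n - k - j).+1 :: nseq i 1%N.
have hookP i : is_partition (hook i).
  by apply/is_partitionP => -[|r]; rewrite /part /= !nth_nseq; do ?case: ifP; lia.
pose S (i : 'I_k) := jacobi_trudi k (toeplitz (hsym R k)) (parts lam) (hook i).
(* The hook has [i.+1] rows, at most [k], so matrices of size [k] suffice. *)
have evalS (i : 'I_k) : evalk k (perp (schur R (hook i)) (schur R (parts lam))) = S i.
  case: hperp => _ _ _ ->//; apply: evalk_skew_schur; rewrite ?size_parts//.
  by rewrite /part nth_default//= size_nseq.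
(* Equating the two values of the determinant, the difference of both sides becomes the sum over [i]
   of [(-1) ^+ i * S i] times the generator of index [i]. *)
exists (fun i : 'I_k => (-1) ^+ i * S i) => [i|].
  by apply: rpredM; [rewrite rpred_sign | exact: jacobi_trudi_sym].
rewrite -truncated_pieri// jacobi_trudi_expand//.
rewrite (@schur_poly_jacobi_trudi _ _ k) ?size_parts// [hsym R k j * _]mulrC.
rewrite opprB opprD addrCA [X in _ + X]addrA subrr add0r.
rewrite -sumrN -big_split; apply: eq_bigr => i _ /=.
rewrite evalS /idealI_gen -/(hook i) -/(S i) -!mul_mpolyC rmorph_sign !exprS.
ring.
Qed.
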